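(* Let $U$ be a rotation-like operator on a complex Banach space $X$, let $\mathcal{A}$ be the associated set of operators, let $w\in\mathcal{A}'$, and let $T=wU$ be the corresponding weighted rotation-like operator. Let $\lambda\in\sigma_{a.p.}(T)$ and let $A\in\mathcal{A}$, with $UAU^{-1}=\gamma_A A$. Assume that $A$ is invertible from the left in $L(X)$. Then $\gamma_A^n\lambda\in\sigma_{a.p.}(T)$ for all $n\in\mathbb{Z}$. Moreover, if $\lambda\in\sigma_2(T)$, then $\gamma_A^n\lambda\in\sigma_2(T)$ for all $n\in\mathbb{Z}$.
   Context: $L(X)$ is the algebra of bounded linear operators on $X$; $\mathbb{T}=\{z\in\mathbb{C}:|z|=1\}$. An invertible operator $U\in L(X)$ is called rotation-like if there are $A\in L(X)$, $A\neq0$, and $\gamma\in\mathbb{T}$, $\gamma\ne1$, with $UAU^{-1}=\gamma A$. For such $U$ put $\mathcal{A}=\{A\in L(X)\setminus\{0\}:\ \exists\,\gamma_A\in\mathbb{T},\ UAU^{-1}=\gamma_A A\}$. $\mathcal{A}'$ denotes the commutant of $\mathcal{A}$ in $L(X)$. A weighted rotation-like operator is an operator $T=wU$ with $U$ rotation-like and $w\in\mathcal{A}'$. $\sigma_{a.p.}(T)=\{\lambda\in\mathbb{C}:\exists x_n\in X,\ \|x_n\|=1,\ Tx_n-\lambda x_n\to0\}$. $\sigma_2(T)$ is the set of $\lambda\in\mathbb{C}$ such that $\lambda I-T$ does not belong to $\Phi_+$, where $\Phi_+$ is the set of operators with closed range and finite-dimensional kernel. *)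

(* Defs.v *)
From HB Require Import structures.
From mathcomp Require Import all_boot all_order all_algebra.
From mathcomp Require Import complex.
From mathcomp Require Import all_classical all_reals all_analysis.

Set Implicit Arguments.
Unset Strict Implicit.
Unset Printing Implicit Defensive.

Import Order.TTheory GRing.Theory Num.Theory.
Import numFieldNormedType.Exports.

Local Open Scope classical_set_scope.
Local Open Scope ring_scope.
Local Open Scope complex_scope.

Section RotationLike.
Context {R : realType} {X : completeNormedModType R[i]}.
Implicit Types (A B S T U V : X -> X) (gamma lambda : R[i]).

(* L(X) *)
Definition bounded_operator : set (X -> X) :=
  [set T | linear T /\ bounded_near T (nbhs (0 : X))].

(* V = U^-1 in L(X); such a V is unique when it exists, which is why the
   definitions below may quantify it existentially. *)
Definition is_inverse U V : Prop :=
  [/\ bounded_operator V, V \o U = id & U \o V = id].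

Definition left_invertible A : Prop :=
  exists B, bounded_operator B /\ B \o A = id.

(* gamma lies on the unit circle and U A U^-1 = gamma A. *)
Definition rotation_coefficient U A gamma : Prop :=
  `|gamma| = 1 /\
  exists V, is_inverse U V /\ U \o A \o V = gamma \*: A.

Definition rotation_like U : Prop :=
  [/\ bounded_operator U,
      exists V, is_inverse U V
    & exists A gamma,
        [/\ bounded_operator A, A <> \0, gamma <> 1
          & rotation_coefficient U A gamma]].

Definition rotation_set U : set (X -> X) :=
  [set A | [/\ bounded_operator A, A <> \0
             & exists gamma, rotation_coefficient U A gamma]].

Definition commutant (F : set (X -> X)) : set (X -> X) :=
  [set B | bounded_operator B /\ forall A, F A -> B \o A = A \o B].

Definition sigma_ap T : set R[i] :=
  [set lambda | exists x : nat -> X,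
     (forall n, `|x n| = 1) /\
     (T (x n) - lambda *: x n @[n --> \oo] --> (0 : X))].

Definition finite_dimensional (E : set X) : Prop :=
  exists (n : nat) (e : 'I_n -> X),
    E = [set x | exists c : 'I_n -> R[i], x = \sum_(i < n) c i *: e i].

(* The upper semi-Fredholm operators. *)
Definition Phi_plus : set (X -> X) :=
  [set S | [/\ bounded_operator S, closed (range S)
             & finite_dimensional (S @^-1` [set 0])]].

Definition sigma_2 T : set R[i] :=
  [set lambda | ~ Phi_plus (lambda \*: id \- T)].

End RotationLike.

(* Main.v *)
Require Import Defs.
From HB Require Import structures.
From mathcomp Require Import all_boot all_order all_algebra.
From mathcomp Require Import complex.
From mathcomp Require Import all_classical all_reals all_analysis.
From mathcomp Require Import lra.

Set Implicit Arguments.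
Unset Strict Implicit.
Unset Printing Implicit Defensive.

Import Order.TTheory GRing.Theory Num.Theory.
Import numFieldNormedType.Exports.

Local Open Scope classical_set_scope.
Local Open Scope ring_scope.
Local Open Scope complex_scope.

(** Let T = wU. From U A = gamma A U and w A = A w one gets T A = gamma A T,
    hence (gamma mu - T) A = gamma A (mu - T) for every scalar mu. If A has a
    left inverse, A carries approximate eigenvectors for mu to approximate
    eigenvectors for gamma mu ([sigma_ap_rotate]), and mu - T is upper
    semi-Fredholm whenever gamma mu - T is ([sigma_2_rotate]). So both spectra
    are stable under multiplication by gamma.

    Negative powers do not come from the algebra, because A need not be
    invertible. They come from topology: both spectra are closed
    ([sigma_ap_closed], [sigma_2_closed]), and some powers gamma^(k+1) come
    arbitrarily close to 1 by the pigeonhole principle, so gamma^(-1) mu is a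
    limit of the points gamma^k mu ([rotation_invariant_closed]).

    What remains is the theory of upper semi-Fredholm operators: closedness of
    sigma_2 and transport along A. Both are read off from a criterion that does
    not involve complements of the kernel: S is upper semi-Fredholm if and only
    if, for some c > 0, the set of vectors x with |x| <= 1 and |S x| <= c can be
    cut into finitely many pieces of diameter at most 1/4, and then any diameter
    can be reached ([Phi_plus_coverable], [coverable_Phi_plus]). This condition
    visibly survives small perturbations ([Phi_plus_open]) and pullback by a
    left invertible operator ([Phi_plus_left_invertible]).

    For the direct implication, a closed range gives an estimate
    dist(x, ker S) <= C |S x| by the open mapping argument
    ([closed_range_ker_dist]), and bounded parts of the kernel are totally
    bounded ([lspan_coverable]). Conversely, the pigeonhole principle
    extracts a convergent subsequence from every sequence in the unit ball whose
    images tend to 0 ([accumulation_point]). This yields the distance estimate,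
    hence closed range, while a finite net of the unit ball of the kernel spans
    the kernel ([coverable_finite_kernel]). *)

(** * Real-valued norms *)

Section RealNorm.
Context {R : realType} {V : normedModType R[i]}.
Implicit Types x y z : V.

(** The library norm of a complex space takes values in [R[i]], whose order is
    only partial; its real part lives in a totally ordered field, where [lra]
    and [nra] apply. *)
Definition rnorm x : R := complex.Re `|x|.

Lemma rnormE x : `|x| = (rnorm x)%:C.
Proof. by rewrite /rnorm RRe_real // normr_real. Qed.

Lemma rnorm_ge0 x : 0 <= rnorm x.
Proof. by rewrite -ler0c -rnormE. Qed.

Lemma rnorm0 : rnorm 0 = 0.
Proof. by rewrite /rnorm normr0. Qed.

Lemma rnorm0_eq0 x : rnorm x = 0 -> x = 0.
Proof. by move=> x0; apply/eqP; rewrite -normr_eq0 rnormE x0. Qed.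

Lemma rnorm_small_eq0 x : (forall e, 0 < e -> rnorm x <= e) -> x = 0.
Proof.
move=> xe; apply: rnorm0_eq0; apply/eqP; rewrite eq_le rnorm_ge0 andbT.
by apply/ler_addgt0Pl => e e0; rewrite addr0; apply: xe.
Qed.

Lemma rnorm_gt0 x : x <> 0 -> 0 < rnorm x.
Proof.
move=> x0; rewrite lt_neqAle rnorm_ge0 andbT eq_sym.
by apply/eqP => /rnorm0_eq0.
Qed.

Lemma rnormD x y : rnorm (x + y) <= rnorm x + rnorm y.
Proof. by rewrite -lecR rmorphD /= -!rnormE ler_normD. Qed.

Lemma rnormN x : rnorm (- x) = rnorm x.
Proof. by rewrite /rnorm normrN. Qed.

Lemma rnormB x y : rnorm (x - y) <= rnorm x + rnorm y.
Proof. by rewrite -(rnormN y) rnormD. Qed.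

Lemma rnorm_sub x y : rnorm (x - y) = rnorm (y - x).
Proof. by rewrite -rnormN opprB. Qed.

Lemma rnorm_tri y x z : rnorm (x - z) <= rnorm (x - y) + rnorm (y - z).
Proof. by rewrite -[x - z](subrKA y) rnormD. Qed.

Lemma normcE_real (c : R[i]) : `|c| = (Normc.normc c)%:C.
Proof. by []. Qed.

Lemma normc_ge0 (c : R[i]) : 0 <= Normc.normc c.
Proof. by case: c => a b; apply: sqrtr_ge0. Qed.

Lemma rnormZ (c : R[i]) x : rnorm (c *: x) = Normc.normc c * rnorm x.
Proof. by apply: complexI; rewrite rmorphM /= -!rnormE normrZ. Qed.

Lemma normc_realE (a : R) : 0 <= a -> Normc.normc a%:C = a.
Proof. by move=> a0; apply: complexI; rewrite -normcE_real ger0_norm // ler0c. Qed.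

Lemma rnormZr (a : R) x : 0 <= a -> rnorm (a%:C *: x) = a * rnorm x.
Proof. by move=> a0; rewrite rnormZ normc_realE. Qed.

End RealNorm.

Section Halves.
Context {R : realType}.

Lemma halves_le (M e : R) : 0 < e ->
  exists N, forall n, (N <= n)%N -> M * 2^-1 ^+ n <= e.
Proof.
move=> e0; exists (Num.bound (M / e)) => n Nn.
rewrite exprVn ler_pdivrMr ?exprn_gt0 // -ler_pdivrMl // mulrC.
exact: ltW (upper_nthrootP Nn).
Qed.

End Halves.

(** * Cauchy sequences *)

Lemma cauchy_limit (K : numFieldType) (V : completeNormedModType K)
    (u : nat -> V) :
  (forall e, 0 < e -> exists N, forall m n, (N <= m)%N -> (N <= n)%N ->
    `|u m - u n| <= e) ->
  exists l, forall e, 0 < e -> exists N, forall n, (N <= n)%N ->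
    `|l - u n| <= e.
Proof.
move=> uC.
have cu : cvg (u @ \oo).
  apply/cauchy_cvgP/cauchy_exP => e e0.
  have [|N uN] := uC (e / 2); first by rewrite divr_gt0.
  exists (u N); exists N => // n /= Nn.
  rewrite -ball_normE /ball_ /=.
  by rewrite (le_lt_trans (uN _ _ _ Nn)) // gtr_pMr // invf_lt1 // ltr1n.
exists (lim (u @ \oo)) => e e0.
have [N _ uN] := (cvgrPdist_le _ _).1 cu e e0.
by exists N.
Qed.

Section Completeness.
Context {R : realType}.

Lemma rnorm_cauchy_limit (X : completeNormedModType R[i]) (u : nat -> X) :
  (forall e, 0 < e -> exists N, forall m n, (N <= m)%N -> (N <= n)%N ->
    rnorm (u m - u n) <= e) ->
  exists l, forall e, 0 < e -> exists N, forall n, (N <= n)%N ->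
    rnorm (l - u n) <= e.
Proof.
move=> uC; have [e e0|l ul] := @cauchy_limit _ _ u.
  have eE : e = (complex.Re e)%:C by rewrite RRe_real // gtr0_real.
  have [|N uN] := uC (complex.Re e); first by rewrite -ltcR -eE.
  by exists N => m n Nm Nn; rewrite rnormE eE lecR uN.
exists l => e e0; have [|N uN] := ul e%:C; first by rewrite ltcR.
by exists N => n Nn; rewrite -lecR -rnormE uN.
Qed.

Lemma normc_ge_Re (c : R[i]) : `|complex.Re c| <= Normc.normc c.
Proof.
case: c => a b /=; rewrite -sqrtr_sqr ler_wsqrtr //.
by rewrite lerDl sqr_ge0.
Qed.

Lemma normc_ge_Im (c : R[i]) : `|complex.Im c| <= Normc.normc c.
Proof.
case: c => a b /=; rewrite -sqrtr_sqr ler_wsqrtr //.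
by rewrite lerDr sqr_ge0.
Qed.

Lemma normc_le_ReIm (c : R[i]) :
  Normc.normc c <= `|complex.Re c| + `|complex.Im c|.
Proof.
case: c => a b /=; rewrite -[leRHS]ger0_norm ?addr_ge0 // -sqrtr_sqr.
rewrite ler_wsqrtr // sqrrD !real_normK ?num_real //.
by rewrite [_ + _ *+ 2 + _]addrAC lerDl mulrn_wge0 // mulr_ge0.
Qed.

Lemma normc_cauchy_limit (u : nat -> R[i]) :
  (forall e : R, 0 < e -> exists N, forall m n, (N <= m)%N -> (N <= n)%N ->
    Normc.normc (u m - u n) <= e) ->
  exists l, forall e : R, 0 < e -> exists N, forall n, (N <= n)%N ->
    Normc.normc (l - u n) <= e.
Proof.
move=> uC.
have [e e0|a ua] := @cauchy_limit R R^o (fun n => complex.Re (u n)).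
  have [N uN] := uC e e0; exists N => m n Nm Nn.
  by rewrite -raddfB (le_trans (normc_ge_Re _)) ?uN.
have [e e0|b ub] := @cauchy_limit R R^o (fun n => complex.Im (u n)).
  have [N uN] := uC e e0; exists N => m n Nm Nn.
  by rewrite -raddfB (le_trans (normc_ge_Im _)) ?uN.
exists (a +i* b) => e e0; have e20 : 0 < e / 2 by lra.
have [N1 u1] := ua _ e20; have [N2 u2] := ub _ e20.
exists (maxn N1 N2) => n; rewrite geq_max => /andP[n1 n2].
have := normc_le_ReIm (a +i* b - u n); rewrite !raddfB /=.
move: (u1 n n1) (u2 n n2); lra.
Qed.

(** The form of completeness that suits successive approximation:
    geometric increments give a limit together with a rate. *)
Lemma geometric_limit (X : completeNormedModType R[i]) (u : nat -> X) (M : R) :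
  (forall n, rnorm (u n.+1 - u n) <= M * 2^-1 ^+ n) ->
  exists l, forall n, rnorm (l - u n) <= 2 * M * 2^-1 ^+ n.
Proof.
move=> uM.
have M0 : 0 <= M by have := uM 0; rewrite expr0 mulr1; apply: le_trans (rnorm_ge0 _).
have tail n k : rnorm (u (n + k)%N - u n) <= 2 * M * 2^-1 ^+ n.
  suff: rnorm (u (n + k)%N - u n) <= 2 * M * (2^-1 ^+ n - 2^-1 ^+ (n + k)).
    move=> /le_trans; apply; rewrite ler_wpM2l ?mulr_ge0 // lerBlDr lerDl.
    by rewrite exprn_ge0.
  elim: k => [|k IH]; first by rewrite addn0 !subrr rnorm0 mulr0.
  rewrite addnS; apply: le_trans (rnorm_tri (u (n + k)%N) _ _) _.
  have := uM (n + k)%N; rewrite exprS.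
  move: IH; set p := _ ^+ (n + k); set q := _ ^+ n; lra.
have [e e0|l ul] := @rnorm_cauchy_limit X u.
  have [N hN] := halves_le (4 * M) e0; exists N => m n Nm Nn.
  apply: le_trans (rnorm_tri (u N) _ _) _; rewrite (rnorm_sub (u N)).
  have := tail N (m - N)%N; have := tail N (n - N)%N; have := hN N (leqnn N).
  rewrite !subnKC //; lra.
exists l => n; apply/ler_addgt0Pl => e e0; have [N uN] := ul e e0.
apply: le_trans (rnorm_tri (u (n + N)%N) _ _) _.
by rewrite lerD ?tail ?uN ?leq_addl.
Qed.

End Completeness.

(** * Closed sets and bounded operators *)

Section BoundedOperators.
Context {R : realType} {X : completeNormedModType R[i]}.
Implicit Types (S T : X -> X) (E : set X).

Lemma closed_approx E x : closed E ->
  (forall e, 0 < e -> exists2 y, E y & rnorm (x - y) <= e) -> E x.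
Proof.
move=> Ec Ex; apply: Ec => B /nbhs_normP [e /= e0 eB].
have eE : e = (complex.Re e)%:C by rewrite RRe_real // gtr0_real.
have e'0 : 0 < complex.Re e by rewrite -ltcR -eE.
have [|y Ey xy] := Ex (complex.Re e / 2); first by lra.
exists y; split => //; apply: eB => /=.
by rewrite rnormE eE ltcR; lra.
Qed.

Lemma approx_closed E :
  (forall x, (forall e, 0 < e -> exists2 y, E y & rnorm (x - y) <= e) -> E x) ->
  closed E.
Proof.
move=> Ex x xE; apply: Ex => e e0.
have [|y [Ey xy]] := xE (ball_ Num.norm x e%:C).
  by apply/nbhs_normP; exists e%:C => //=; rewrite ltcR.
by exists y => //; move: xy; rewrite /ball_ /= rnormE ltcR => /ltW.
Qed.

Section Linear.
Context (S : X -> X) (linS : linear S).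

Lemma linear_add : forall x y, S (x + y) = S x + S y.
Proof. by move=> x y; have := linS 1 x y; rewrite !scale1r. Qed.

Lemma linear_at0 : S 0 = 0.
Proof.
have := linear_add 0 0; rewrite addr0 => /(congr1 (fun z => z - S 0)).
by rewrite addrK subrr.
Qed.

Lemma linear_scale c x : S (c *: x) = c *: S x.
Proof. by have := linS c x 0; rewrite linear_at0 !addr0. Qed.

Lemma linear_sub x y : S (x - y) = S x - S y.
Proof. by rewrite linear_add -scaleN1r linear_scale scaleN1r. Qed.

End Linear.

(** Boundedness near 0 of a linear map is a global Lipschitz bound; the
    constant is made positive so that it can be divided by. *)
Lemma bounded_operatorP S : bounded_operator S <->
  linear S /\ exists2 M, 0 < M & forall x, rnorm (S x) <= M * rnorm x.
Proof.
split=> [[linS bS]|[linS [M M0 SM]]]; split=> //.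
  pose L : {linear X -> X} := HB.pack S (GRing.isLinear.Build _ _ _ _ S linS).
  have /linear_boundedP [m [mr Sm]] : bounded_near L (nbhs 0) by [].
  exists (`|complex.Re m| + 1) => [|x]; first by rewrite ltr_wpDl.
  rewrite -lecR rmorphM /= -!rnormE; apply: Sm.
  by rewrite -[ltLHS]RRe_real // ltcR ltr_pwDr // ler_norm.
pose L : {linear X -> X} := HB.pack S (GRing.isLinear.Build _ _ _ _ S linS).
apply: (iffRL (linear_boundedP L)); exists M%:C; split.
  by rewrite complex_real.
move=> r Mr x; rewrite rnormE; apply: le_trans (_ : M%:C * `|x| <= _).
  by rewrite !rnormE -rmorphM lecR /=; exact: SM.
by rewrite ler_wpM2r // ltW.
Qed.

End BoundedOperators.

(** * Total boundedness of balls of finite-dimensional subspaces *)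

Section Covers.
Context {R : realType}.

(** Cutting [-M, M] into cells of length e; the map g sends a number to the
    index of its cell. *)
Lemma real_grid (M e : R) : 0 < e -> exists (m : nat) (g : R -> 'I_m.+1),
  forall s t, `|s| <= M -> `|t| <= M -> g s = g t -> `|s - t| <= e.
Proof.
move=> e0; pose k t := Num.truncn ((t + M) / e).
exists (Num.truncn ((M + M) / e)), (fun t => inord (k t)) => s t sM tM.
have kP u : `|u| <= M -> [/\ (k u <= Num.truncn ((M + M) / e))%N,
    (k u)%:R * e <= u + M & u + M < (k u)%:R * e + e].
  rewrite ler_norml => /andP[uM Mu]; have u0 : 0 <= u + M by lra.
  have /truncn_itv /andP[k1 k2] : 0 <= (u + M) / e by rewrite divr_ge0 // ltW.
  split; last 2 first.
  - by rewrite -ler_pdivlMr.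
  - by rewrite -{2}[e]mul1r -mulrDl natr1 -ltr_pdivrMr.
  by apply: le_truncn; rewrite ler_pM2r ?invr_gt0 // lerD2r.
have [ks ks1 ks2] := kP s sM; have [kt kt1 kt2] := kP t tM.
move=> /(congr1 val); rewrite /= !inordK ?ltnS // => kst.
by rewrite ler_norml; move: ks1 ks2 kt1 kt2; rewrite kst; lra.
Qed.

Lemma complex_grid (M e : R) : 0 < e -> exists (T : finType) (g : R[i] -> T),
  forall a b, Normc.normc a <= M -> Normc.normc b <= M -> g a = g b ->
    Normc.normc (a - b) <= e.
Proof.
move=> e0; have e20 : 0 < e / 2 by lra.
have [m [g gP]] := real_grid M e20.
exists ('I_m.+1 * 'I_m.+1)%type, (fun c => (g (complex.Re c), g (complex.Im c))).
move=> a b aM bM [gR gI].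
have := gP _ _ (le_trans (normc_ge_Re a) aM) (le_trans (normc_ge_Re b) bM) gR.
have := gP _ _ (le_trans (normc_ge_Im a) aM) (le_trans (normc_ge_Im b) bM) gI.
have := normc_le_ReIm (a - b); rewrite !raddfB /=; lra.
Qed.

End Covers.

Section FiniteDimension.
Context {R : realType} {X : completeNormedModType R[i]}.
Implicit Types (K E : set X) (x y z v : X) (s : seq X).

(** A finite colouring with small colour classes on K: total boundedness at
    scale e. Compared with finite nets, colourings combine by
    pairing and pull back by composition. *)
Definition coverable K (e : R) := exists (T : finType) (f : X -> T),
  forall x y, K x -> K y -> f x = f y -> rnorm (x - y) <= e.

(** The span is described by recursion on the list, so that every statement
    about finite-dimensional spaces is proved by adding one vector at a time. *)
Fixpoint lspan s : set X :=
  if s is v :: s' then [set x | exists c, lspan s' (x - c *: v)] else [set 0].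

Lemma lspan0 s : lspan s 0.
Proof. by elim: s => //= v s IH; exists 0; rewrite scale0r subr0. Qed.

Lemma lspan_lin s c x y : lspan s x -> lspan s y -> lspan s (c *: x + y).
Proof.
elim: s x y => [|v s IH] x y /=; first by move=> -> ->; rewrite scaler0 addr0.
move=> [a xa] [b yb]; exists (c * a + b).
by rewrite scalerDl -scalerA opprD addrACA -scalerBr; apply: IH.
Qed.

Lemma lspanZ s c x : lspan s x -> lspan s (c *: x).
Proof. by move=> /(lspan_lin c)/(_ (lspan0 s)); rewrite addr0. Qed.

Lemma lspanD s x y : lspan s x -> lspan s y -> lspan s (x + y).
Proof. by move=> /(lspan_lin 1) sx /sx; rewrite scale1r. Qed.

Lemma lspan_cons s v : lspan s `<=` lspan (v :: s).
Proof. by move=> x sx; exists 0; rewrite scale0r subr0. Qed.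

Lemma mem_lspan s x : x \in s -> lspan s x.
Proof.
elim: s => //= v s IH; rewrite inE => /orP[/eqP ->|/IH]; last exact: lspan_cons.
by exists 1; rewrite scale1r subrr; apply: lspan0.
Qed.

Lemma lspan_sumP s x : lspan s x <->
  exists c : nat -> R[i], x = \sum_(i < size s) c i *: s`_i.
Proof.
elim: s x => [|v s IH] x /=.
  split=> [->|[c ->]]; last by rewrite big_ord0.
  by exists (fun=> 0); rewrite big_ord0.
split=> [[a /IH [c xc]]|[c ->]].
  exists (fun n => if n is n'.+1 then c n' else a).
  by rewrite big_ord_recl /= -xc addrC subrK.
by exists (c 0%N); apply/IH; exists (c \o S); rewrite big_ord_recl /= addrC addKr.
Qed.

Lemma finite_dimensionalP E : finite_dimensional E <-> exists s, E = lspan s.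
Proof.
split=> [[n [e ->]]|[s ->]].
  pose s := [seq e i | i <- enum 'I_n].
  have sn : size s = n by rewrite size_map size_enum_ord.
  have se (i : 'I_n) : s`_i = e i by rewrite (nth_map i) ?size_enum_ord // nth_ord_enum.
  exists s; apply/seteqP; split=> x.
    move=> [c ->]; apply/lspan_sumP; rewrite sn.
    exists (fun k => if insub k is Some i then c i else 0).
    by apply: eq_bigr => i _; rewrite se valK.
  move=> /lspan_sumP; rewrite sn => -[c ->]; exists (c \o val).
  by apply: eq_bigr => i _; rewrite se.
exists (size s), (fun i => s`_i); apply/seteqP; split=> x.
  by move=> /lspan_sumP [c ->]; exists (c \o val).
move=> [c ->]; apply/lspan_sumP.
exists (fun k => if insub k is Some i then c i else 0).
by apply: eq_bigr => i _; rewrite valK.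
Qed.

Lemma lspan_min (E : set X) s : E 0 ->
  (forall c x y, E x -> E y -> E (c *: x + y)) ->
  (forall v, v \in s -> E v) -> lspan s `<=` E.
Proof.
move=> E0 Elin; elim: s => [_ x ->//|v s IH] sE x [c sx].
rewrite -(subrK (c *: v) x) addrC; apply: Elin.
  by apply: sE; rewrite mem_head.
by apply: IH => // z zs; apply: sE; rewrite inE zs orbT.
Qed.

Lemma coverable_net K e : K 0 -> coverable K e ->
  exists s, (forall z, z \in s -> K z) /\
    forall x, K x -> exists2 z, z \in s & rnorm (x - z) <= e.
Proof.
move=> K0 [T [f fP]].
have /choice [rep repP] : forall t, exists z,
    K z /\ ((exists2 x, K x & f x = t) -> f z = t).
  move=> t; have [[x Kx xt]|nx] := pselect (exists2 x, K x & f x = t).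
    by exists x.
  by exists 0.
exists [seq rep t | t <- enum T]; split=> [_ /mapP[t _ ->]|x Kx].
  by have [] := repP t.
exists (rep (f x)); first by apply: map_f; rewrite mem_enum.
have [Kz fz] := repP (f x).
by apply: fP => //; rewrite fz //; exists x.
Qed.

Definition lspan_dist_gt0 s v := exists2 d, 0 < d &
  forall c y, lspan s y -> Normc.normc c * d <= rnorm (c *: v + y).

Definition lspan_dense s v := forall x, lspan (v :: s) x ->
  forall e, 0 < e -> exists2 y, lspan s y & rnorm (x - y) <= e.

(** Adding v to the span of s either leaves v at positive distance, and then
    the coefficient of v is controlled by the norm, or adds nothing up to
    closure. Both inductions over spans split along these cases. *)
Lemma lspan_dichotomy s v : lspan_dist_gt0 s v \/ lspan_dense s v.
Proof.
have [[d d0 dP]|nd] := pselect (exists2 d, 0 < d &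
    forall y, lspan s y -> d <= rnorm (v + y)).
  left; exists d => // c y sy; have [->|c0] := eqVneq c 0.
    by rewrite Normc.normc0 mul0r rnorm_ge0.
  rewrite -[y](scalerKV c0) -scalerDr rnormZ ler_wpM2l ?dP //.
    exact: normc_ge0.
  exact: lspanZ.
right=> x [c sx] e e0.
have n0 := normc_ge0 c.
have [y sy vy] : exists2 y, lspan s y & rnorm (v + y) < e / (Normc.normc c + 1).
  apply: contrapT => ny; apply: nd; exists (e / (Normc.normc c + 1)).
    by rewrite divr_gt0 // ltr_wpDl.
  move=> y sy; rewrite leNgt; apply/negP => vy; apply: ny.
  by exists y.
exists (x - c *: v - c *: y).
  by apply: lspanD => //; rewrite -scaleNr; apply: lspanZ.
rewrite -addrA -opprD -scalerDr opprB addrC subrK rnormZ.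
apply: le_trans (_ : (Normc.normc c + 1) * rnorm (v + y) <= _).
  by rewrite ler_wpM2r ?rnorm_ge0 // lerDl.
by rewrite mulrC -ler_pdivlMr ?ltr_wpDl // ltW.
Qed.

(** Induction on s. When v is at positive distance, the coefficient of v and
    the remaining component in the span of s are bounded, and the two
    colourings are paired; when the span of s is dense, points are first moved
    into it. *)
Lemma lspan_coverable s r e : 0 < e ->
  coverable [set x | lspan s x /\ rnorm x <= r] e.
Proof.
elim: s r e => [|v s IH] r e e0.
  exists unit, (fun=> tt) => x y [-> _] [-> _] _; rewrite subrr rnorm0; exact: ltW.
have [[d d0 dP]|sd] := lspan_dichotomy s v; last first.
  have e30 : 0 < e / 3 by lra.
  have /choice [p pP] : forall x, exists y, lspan (v :: s) x ->
      lspan s y /\ rnorm (x - y) <= e / 3.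
    move=> x; have [sx|nsx] := pselect (lspan (v :: s) x); last by exists 0.
    by have [y sy xy] := sd x sx _ e30; exists y.
  have [T [f fP]] := IH (r + e / 3) _ e30.
  have pK x : lspan (v :: s) x -> rnorm x <= r -> lspan s (p x) /\ rnorm (p x) <= r + e / 3.
    move=> /pP [sp xp] xr; split=> //.
    have := rnorm_tri x (p x) 0; rewrite !subr0 rnorm_sub; lra.
  exists T, (f \o p) => x y [sx xr] [sy yr] /(fP _ _ (pK _ sx xr) (pK _ sy yr)).
  have [_ xp] := pP x sx; have [_ yp] := pP y sy.
  have := rnorm_tri (p x) x y; have := rnorm_tri (p y) (p x) y.
  rewrite (rnorm_sub (p y) y); lra.
have /choice [c cP] : forall x, exists c, lspan (v :: s) x -> lspan s (x - c *: v).
  move=> x; have [[c sx]|nsx] := pselect (lspan (v :: s) x); last by exists 0.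
  by exists c.
have cr x : lspan (v :: s) x -> rnorm x <= r -> Normc.normc (c x) <= r / d.
  move=> /cP /(dP (c x)); rewrite addrC subrK ler_pdivlMr //; exact: le_trans.
have v1 : 0 < 2 * (rnorm v + 1) by rewrite mulr_gt0 // ltr_wpDl // rnorm_ge0.
have [T [g gP]] := complex_grid (r / d) (divr_gt0 e0 v1).
have e20 : 0 < e / 2 by lra.
have [U [f fP]] := IH (r + r / d * rnorm v) _ e20.
exists (T * U)%type, (fun x => (g (c x), f (x - c x *: v))).
move=> x y [sx xr] [sy yr] [gxy fxy].
have yK z : lspan (v :: s) z -> rnorm z <= r ->
    lspan s (z - c z *: v) /\ rnorm (z - c z *: v) <= r + r / d * rnorm v.
  move=> sz zr; split; first exact: cP.
  apply: le_trans (rnormB _ _) _; rewrite lerD // rnormZ.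
  by rewrite ler_wpM2r ?rnorm_ge0 ?cr.
have := fP _ _ (yK _ sx xr) (yK _ sy yr) fxy.
have := gP _ _ (cr _ sx xr) (cr _ sy yr) gxy.
rewrite ler_pdivlMr // => h1 h2.
have -> : x - y = (x - c x *: v - (y - c y *: v)) + (c x - c y) *: v.
  by rewrite scalerBl opprB addrACA subrK [c y *: v - y - _]addrAC subrr add0r.
apply: le_trans (rnormD _ _) _; rewrite rnormZ.
have := rnorm_ge0 v.
have n0 := normc_ge0 (c x - c y).
nra.
Qed.

(** In the non-degenerate case, the coefficients of v along a
    convergent sequence form a Cauchy sequence of complex numbers; subtracting
    their limit reduces the claim to a shorter list. *)
Lemma lspan_closed s : closed (lspan s).
Proof.
elim: s => [|v s IH]; apply: approx_closed => x xs.
  apply: rnorm_small_eq0 => e e0.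
  by have [y ->] := xs e e0; rewrite subr0.
have [[d d0 dP]|sd] := lspan_dichotomy s v; last first.
  apply/lspan_cons/(closed_approx IH) => e e0; have e20 : 0 < e / 2 by lra.
  have [y sy xy] := xs _ e20; have [z sz yz] := sd y sy _ e20.
  exists z => //; have := rnorm_tri y x z; lra.
have /choice [u uP] : forall n, exists y, lspan (v :: s) y /\ rnorm (x - y) <= 2^-1 ^+ n.
  by move=> n; have [|y] := xs (2^-1 ^+ n); [rewrite exprn_gt0|exists y].
have /choice [c cP] : forall n, exists c, lspan s (u n - c *: v).
  by move=> n; have [[c ?] _] := uP n; exists c.
have cC m n : Normc.normc (c m - c n) * d <= rnorm (u m - u n).
  have -> : u m - u n = (c m - c n) *: v + (u m - u n - (c m - c n) *: v).
    by rewrite [RHS]addrC subrK.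
  apply: dP.
  have := lspan_lin (-1) (cP n) (cP m); rewrite scaleN1r scalerBl.
  rewrite [- _ + _]addrC !opprB addrACA.
  by rewrite [X in _ -> lspan s X]addrACA [- u n - _]addrC.
have [e e0|a ca] := @normc_cauchy_limit R c.
  have de0 : 0 < d * e by rewrite mulr_gt0.
  have [N NP] := halves_le 2 de0; exists N => m n Nm Nn.
  rewrite -(ler_pM2r d0) (le_trans (cC m n)) //.
  have := rnorm_tri x (u m) (u n); rewrite (rnorm_sub (u m) x).
  have [_] := uP m; have [_] := uP n; have := NP m Nm; have := NP n Nn; lra.
exists a; apply: (closed_approx IH) => e e0; have e20 : 0 < e / 2 by lra.
have v1 : 0 < 2 * (rnorm v + 1) by rewrite mulr_gt0 // ltr_wpDl // rnorm_ge0.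
have [N1 h1] := ca _ (divr_gt0 e0 v1); have [N2 h2] := halves_le 1 e20.
pose n := maxn N1 N2; exists (u n - c n *: v); first exact: cP.
have -> : x - a *: v - (u n - c n *: v) = (x - u n) - (a - c n) *: v.
  by rewrite scalerBl !opprB addrACA [RHS]addrACA [- u n - _]addrC.
apply: le_trans (rnormB _ _) _; rewrite rnormZ.
have [_] := uP n; have := h2 n (leq_maxr _ _).
have := h1 n (leq_maxl _ _); rewrite ler_pdivlMr //.
have n0 := normc_ge0 (a - c n).
have := rnorm_ge0 v; nra.
Qed.

End FiniteDimension.

(** * Closed range and the distance to the kernel *)

Section ClosedRange.
Context {R : realType} {X : completeNormedModType R[i]}.
Implicit Types (S : X -> X) (E : set X) (x y z : X).

(** The Baire category theorem for a closed subset E of a Banach space. If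
    every V n were nowhere dense in E, balls with centres in E could be nested
    so that the ball of step n + 1 avoids V n; the common point of these balls
    would lie in no V n. *)
Lemma baire_closed_cover E (V : nat -> set X) y0 : closed E -> E y0 ->
  (forall y, E y -> exists n, V n y) ->
  exists n y1 (r : R), [/\ E y1, 0 < r & forall y, E y -> rnorm (y - y1) <= r ->
    forall e, 0 < e -> exists2 z, V n z & rnorm (y - z) <= e].
Proof.
move=> Ec Ey0 EV; apply: contrapT => nP.
have /choice [F FP] : forall a : nat * (X * R), exists q : X * R,
    E a.2.1 -> 0 < a.2.2 -> [/\ E q.1, 0 < q.2, rnorm (q.1 - a.2.1) <= a.2.2 / 2,
      q.2 <= a.2.2 / 2 & forall z, V a.1 z -> 2 * q.2 < rnorm (q.1 - z)].
  move=> [n [y r]] /=.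
  have [[Ey r0]|nEr] := pselect (E y /\ 0 < r); last first.
    by exists (y, r) => Ey r0; case: nEr.
  apply: contrapT => nq; apply: nP; exists n, y, (r / 2); split=> //; first by lra.
  move=> y1 Ey1 y1y e e0; apply: contrapT => nz; apply: nq.
  (* The radius is at most e / 2, which keeps V n out of the concentric
     ball of twice that radius. *)
  exists (y1, Num.min (e / 2) (r / 2)) => _ _ /=; split=> //.
  - by rewrite lt_min; apply/andP; split; lra.
  - by rewrite ge_min lexx orbT.
  move=> z Vz; apply: (@le_lt_trans _ _ e).
    have : Num.min (e / 2) (r / 2) <= e / 2 by rewrite ge_min lexx.
    lra.
  by rewrite ltNge; apply/negP => yz; apply: nz; exists z.
pose p := fix p n := if n is m.+1 then F (m, p m) else (y0, 1 : R).
have pP n : E (p n).1 /\ 0 < (p n).2.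
  by elim: n => [|n [IH1 IH2]] //=; have [] := FP (n, p n) IH1 IH2.
have pS n := let: conj h1 h2 := pP n in FP (n, p n) h1 h2.
have tail n k : rnorm ((p (n + k)%N).1 - (p n).1) <= (p n).2 - (p (n + k)%N).2.
  elim: k => [|k IH]; first by rewrite addn0 !subrr rnorm0.
  rewrite addnS; apply: le_trans (rnorm_tri (p (n + k)%N).1 _ _) _.
  by have [_ _] := pS (n + k)%N; rewrite /= => + + _; lra.
have p2 n : (p n).2 <= 2^-1 ^+ n.
  elim: n => [|n IH]; first by rewrite expr0.
  by rewrite exprS; have [_ _ _] := pS n; rewrite /= => + _; lra.
have [n|l lP] := @geometric_limit R X (fun n => (p n).1) 1.
  rewrite mul1r; apply: le_trans (p2 n).
  have := tail n 1; rewrite addn1; have [_] := pP n.+1; lra.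
have lp n : rnorm (l - (p n).1) <= (p n).2.
  apply/ler_addgt0Pl => e e0; have [N hN] := halves_le (2 * 1) e0.
  apply: le_trans (rnorm_tri (p (n + N)%N).1 _ _) _.
  have := tail n N; have [_] := pP (n + N)%N.
  have := lP (n + N)%N; have := hN (n + N)%N (leq_addl _ _); lra.
have [|n Vl] := EV l.
  apply: (closed_approx Ec) => e e0; have [N hN] := halves_le 1 e0.
  exists (p N).1; first by have [] := pP N.
  by have := lp N; have := p2 N; have := hN N (leqnn _); lra.
have [_ h _ _] := pS n => /(_ l Vl); have := lp n.+1.
by move: h; rewrite /= (rnorm_sub l); lra.
Qed.

(** The map induced by S on the quotient by its kernel is bounded below; a
    nearby element of the kernel stands for the quotient norm. *)
Definition ker_dist_le S (C : R) :=
  forall x, exists2 z, S z = 0 & rnorm (x - z) <= C * rnorm (S x).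

(** The open mapping argument. The images of the balls of integer radius
    cover the range, so one of them is dense in some ball of the range; by
    translation and scaling each x is corrected by some x' of norm
    at most C |S x| in such a way that the image is halved. The corrections add
    up to a vector that differs from x by an element of the kernel. *)
Lemma closed_range_ker_dist S : bounded_operator S -> closed (range S) ->
  exists2 C, 0 < C & ker_dist_le S C.
Proof.
move=> /bounded_operatorP [linS [M M0 SM]] cS.
(* Some image of a ball is dense in the ball of radius r about S x1 in
   the range. *)
have [||n [_ [r [[x1 _ <-] r0 dense]]]] := @baire_closed_cover _
    (fun n => S @` [set x | rnorm x <= n%:R]) (S 0) cS.
- by exists 0.
- move=> _ [x _ <-]; exists (Num.bound (rnorm x)), x => //=.
  exact: ltW (archi_boundP (rnorm_ge0 _)).
pose C := (2 * n%:R + 1) / r.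
have C0 : 0 < C by rewrite divr_gt0 // ltr_wpDl // mulr_ge0.
have /choice [g gP] : forall x, exists x',
    rnorm x' <= C * rnorm (S x) /\ rnorm (S (x - x')) <= rnorm (S x) / 2.
  move=> x; have [Sx0|Sx0] := pselect (S x = 0).
    by exists 0; rewrite subr0 Sx0 !rnorm0 mulr0 mul0r.
  have y0 := rnorm_gt0 Sx0; set y := rnorm (S x) in y0 *.
  pose t := r / y; have t0 : 0 < t by rewrite divr_gt0.
  have r40 : 0 < r / 4 by lra.
  (* The vector S x is recovered as the difference of S x1 + t S x and
     S x1, both approximated within r / 4. *)
  have [||_ [a an <-] ya] := dense (S (x1 + t%:C *: x)) _ _ _ r40.
  - by exists (x1 + t%:C *: x).
  - rewrite -(linear_sub linS) [x1 + _]addrC addrK (linear_scale linS) rnormZr ?(ltW t0) //.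
    by rewrite divfK ?gt_eqF.
  have [||_ [b bn <-] yb] := dense (S x1) _ _ _ r40.
  - by exists x1.
  - by rewrite subrr rnorm0 ltW.
  have tC : t%:C != 0 by rewrite (inj_eq (@complexI R)) gt_eqF.
  have tV0 : 0 <= t^-1 by rewrite invr_ge0 ltW.
  have tVE : t^-1 = y / r by rewrite invf_div.
  exists (t^-1%:C *: (a - b)); split.
    rewrite rnormZr // tVE mulrAC /C [leRHS]mulrAC ler_pM2r ?invr_gt0 //.
    have := rnormB a b; move: an bn; rewrite /= => an bn ab.
    by rewrite mulrC ler_pM2r //; lra.
  have -> : x - t^-1%:C *: (a - b) = t^-1%:C *: ((x1 + t%:C *: x - a) - (x1 - b)).
    rewrite -[in LHS](scalerK tC x) -fmorphV -scalerBr; congr (_ *: _).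
    rewrite [x1 + _]addrC -addrA -addrA; congr (_ + _).
    by rewrite !opprB addrA [x1 - a]addrC addrACA subrr addr0 addrC.
  rewrite (linear_scale linS) rnormZr // tVE (linear_sub linS).
  rewrite (linear_sub linS _ a) (linear_sub linS _ b).
  have := rnormB (S (x1 + t%:C *: x) - S a) (S x1 - S b) => h.
  rewrite mulrAC ler_pdivrMr // mulrAC -mulrA ler_pM2l //; lra.
exists (2 * C); first by rewrite mulr_gt0.
move=> x; pose u := fix u n := if n is m.+1 then u m - g (u m) else x.
have uS k : rnorm (S (u k)) <= rnorm (S x) * 2^-1 ^+ k.
  elim: k => [|k IH]; first by rewrite expr0 mulr1.
  by rewrite exprS /=; have [_] := gP (u k); lra.
have [k|l lu] := @geometric_limit R X u (C * rnorm (S x)).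
  rewrite /= addrAC subrr add0r rnormN; have [gk _] := gP (u k).
  by apply: le_trans gk _; rewrite -[leRHS]mulrA ler_wpM2l // ltW.
exists l; last by have := lu 0%N; rewrite /= expr0 mulr1 mulrA rnorm_sub.
apply: rnorm_small_eq0 => e e0.
have [N hN] := halves_le (M * (2 * (C * rnorm (S x))) + rnorm (S x)) e0.
apply: le_trans (hN N (leqnn N)); rewrite mulrDl -mulrA.
have -> : S l = S (l - u N) + S (u N) by rewrite -(linear_add linS) subrK.
apply: le_trans (rnormD _ _) _; rewrite lerD // (le_trans (SM _)) //.
by rewrite ler_wpM2l // ltW.
Qed.

(** Given approximants S (x n) of y, the preimages are modified by elements
    of the kernel until they form a Cauchy sequence; its limit is a preimage
    of y. *)
Lemma ker_dist_closed_range S C : bounded_operator S -> 0 < C ->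
  ker_dist_le S C -> closed (range S).
Proof.
move=> /bounded_operatorP [linS [M M0 SM]] C0 SC.
apply: approx_closed => y Sy.
have /choice [x xP] : forall n, exists x, rnorm (y - S x) <= 2^-1 ^+ n.
  by move=> n; have [|_ [x _ <-]] := Sy (2^-1 ^+ n); [rewrite exprn_gt0|exists x].
have /choice [g gP] : forall x, exists x', S x' = S x /\ rnorm x' <= C * rnorm (S x).
  move=> a; have [z Sz az] := SC a; exists (a - z); split => //.
  by rewrite (linear_sub linS) Sz subr0.
pose u := fix u n := if n is m.+1 then u m + g (x n - x m) else x 0%N.
have Su n : S (u n) = S (x n).
  elim: n => //= n IH; rewrite (linear_add linS) IH.
  by have [-> _] := gP (x n.+1 - x n); rewrite (linear_sub linS) addrC subrK.
have [n|l lu] := @geometric_limit R X u (2 * C).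
  rewrite /= addrAC subrr add0r; have [_ gn] := gP (x n.+1 - x n).
  apply: le_trans gn _; rewrite [2 * C]mulrC -mulrA ler_wpM2l ?(ltW C0) // (linear_sub linS).
  apply: le_trans (rnorm_tri y _ _) _; rewrite (rnorm_sub (S (x n.+1)) y).
  have := xP n.+1; have := xP n; rewrite exprS.
  have : 0 <= 2^-1 ^+ n :> R by rewrite exprn_ge0.
  lra.
exists l => //; apply/eqP; rewrite -subr_eq0; apply/eqP.
apply: rnorm_small_eq0 => e e0.
have [N hN] := halves_le (M * (2 * (2 * C)) + 1) e0.
apply: le_trans (hN N (leqnn N)); rewrite mulrDl -mulrA mul1r.
apply: le_trans (rnorm_tri (S (u N)) _ _) _; rewrite lerD //.
  by rewrite -(linear_sub linS) (le_trans (SM _)) // ler_wpM2l // ltW.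
by rewrite Su rnorm_sub.
Qed.

End ClosedRange.

(** * A compactness criterion for upper semi-Fredholm operators *)

Section Criterion.
Context {R : realType} {X : completeNormedModType R[i]}.
Implicit Types (S A B : X -> X) (x y z : X).

(** The vectors of the unit ball that S almost kills; S is upper semi-Fredholm
    exactly when this set is totally bounded at scale 1/4 for some c > 0. *)
Definition almost_kernel S (c : R) : set X :=
  [set x | rnorm x <= 1 /\ rnorm (S x) <= c].

(** A vector of the unit ball with small image is close to the kernel, hence
    close to a bounded part of a finite-dimensional space. *)
Lemma Phi_plus_coverable S (e : R) : Phi_plus S -> 0 < e ->
  exists2 c, 0 < c & coverable (almost_kernel S c) e.
Proof.
move=> [bS cS fS] e0; have [C C0 SC] := closed_range_ker_dist bS cS.
have [s kerS] := (finite_dimensionalP _).1 fS.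
have e30 : 0 < e / 3 by lra.
have /choice [p pP] : forall x, exists z,
    lspan s z /\ rnorm (x - z) <= C * rnorm (S x).
  by move=> x; have [z Sz xz] := SC x; exists z; rewrite -kerS.
have [T [f fP]] := lspan_coverable s (1 + e / 3) e30.
exists (e / 3 / C); first by rewrite divr_gt0.
have near x : almost_kernel S (e / 3 / C) x -> rnorm (x - p x) <= e / 3.
  move=> [_ Sx]; have [_ xp] := pP x; apply: le_trans xp _.
  by rewrite mulrC -ler_pdivlMr.
have pK x : almost_kernel S (e / 3 / C) x -> lspan s (p x) /\ rnorm (p x) <= 1 + e / 3.
  move=> Kx; have [sp _] := pP x; split=> //.
  have [x1 _] := Kx; have := near x Kx; rewrite rnorm_sub.
  by have := rnormD (p x - x) x; rewrite subrK; lra.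
exists T, (f \o p) => x y Kx Ky /(fP _ _ (pK _ Kx) (pK _ Ky)).
have := near x Kx; have := near y Ky.
have := rnorm_tri (p x) x y; have := rnorm_tri (p y) (p x) y.
rewrite (rnorm_sub (p y) y); lra.
Qed.

Definition unbounded_set (I : set nat) := forall N, exists2 n, (N <= n)%N & I n.

Lemma unbounded_pigeonhole (T : finType) (g : nat -> T) (I : set nat) :
  unbounded_set I -> exists t, unbounded_set (I `&` [set n | g n = t]).
Proof.
move=> uI; apply: contrapT => nt.
have /choice [N NP] : forall t, exists N, forall n, (N <= n)%N -> I n -> g n <> t.
  move=> t; apply: contrapT => nN; apply: nt; exists t => N.
  apply: contrapT => nn; apply: nN; exists N => n Nn In gn; apply: nn.
  by exists n.
have [n Nn In] := uI (\max_t N t)%N.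
by apply: (NP (g n) n) => //; apply: leq_trans Nn; apply: leq_bigmax.
Qed.

Definition diam_le (u : nat -> X) (I : set nat) (r : R) :=
  forall m n, I m -> I n -> rnorm (u m - u n) <= r.

(** Colouring the vectors (u n - u n0) / r shows that an infinite set of
    indices on which u has diameter at most r contains an infinite subset of
    diameter at most r / 2, provided its indices are large enough for S (u n)
    to be small against r. Iterating and choosing one index from each set
    produces a Cauchy subsequence. *)
Lemma accumulation_point S c (u : nat -> X) : linear S -> 0 < c ->
  coverable (almost_kernel S c) (1 / 4) -> (forall n, rnorm (u n) <= 1) ->
  (forall e, 0 < e -> exists N, forall n, (N <= n)%N -> rnorm (S (u n)) <= e) ->
  exists l, forall e, 0 < e -> forall N, exists2 n, (N <= n)%N & rnorm (l - u n) <= e.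
Proof.
move=> linS c0 [T [f fP]] u1 Su.
have /choice [F FP] : forall a : set nat * R, exists J,
    unbounded_set a.1 -> diam_le u a.1 a.2 -> 0 < a.2 ->
    [/\ J `<=` a.1, unbounded_set J & diam_le u J (a.2 / 2)].
  move=> [I r] /=.
  have [[uI dI r0]|nI] := pselect [/\ unbounded_set I, diam_le u I r & 0 < r];
    last by exists I => h1 h2 h3; case: nI.
  (* Beyond N0 the rescaled differences v n stay in the almost kernel. *)
  have [|N0 SN0] := Su (c * r / 2); first by rewrite divr_gt0 // mulr_gt0.
  have [n0 N0n In0] := uI N0.
  pose v n := r^-1%:C *: (u n - u n0).
  have rV0 : 0 <= r^-1 by rewrite invr_ge0 ltW.
  have vK n : (N0 <= n)%N -> I n -> almost_kernel S c (v n).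
    move=> Nn In; split.
      by rewrite rnormZr // mulrC ler_pdivrMr // mul1r dI.
    rewrite (linear_scale linS) rnormZr // mulrC ler_pdivrMr //.
    rewrite (linear_sub linS); have := rnormB (S (u n)) (S (u n0)).
    have := SN0 n Nn; have := SN0 n0 N0n; lra.
  have uI' : unbounded_set (I `&` [set n | (N0 <= n)%N]).
    move=> N; have [n + In] := uI (maxn N N0).
    by rewrite geq_max => /andP[Nn N0n']; exists n.
  have [t ut] := unbounded_pigeonhole (f \o v) uI'.
  exists (I `&` [set n | (N0 <= n)%N] `&` [set n | (f \o v) n = t]) => _ _ _.
  split=> // [n [[]] //|m n [[Im Nm] fm] [[In Nn] fn]].
  have := fP _ _ (vK m Nm Im) (vK n Nn In) (etrans fm (esym fn)).
  rewrite /v -scalerBr opprB addrA subrK rnormZr // mulrC ler_pdivrMr //; lra.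
pose J := fix J n := if n is m.+1 then F (J m, 2 * 2^-1 ^+ m) else setT.
have JP n : unbounded_set (J n) /\ diam_le u (J n) (2 * 2^-1 ^+ n).
  elim: n => [|n [uJ dJ]] /=; last first.
    have [|_ uF dF] := FP (J n, 2 * 2^-1 ^+ n) uJ dJ; first by rewrite mulr_gt0 ?exprn_gt0.
    by split=> // m k Jm Jk; have := dF m k Jm Jk; rewrite exprS /=; lra.
  split; first by move=> N; exists N.
  move=> m n _ _; rewrite expr0 mulr1; have := rnormB (u m) (u n).
  have := u1 m; have := u1 n; lra.
have JS n : J n.+1 `<=` J n.
  have [uJ dJ] := JP n; have [|sub _ _] := FP (J n, 2 * 2^-1 ^+ n) uJ dJ => //.
  by rewrite mulr_gt0 ?exprn_gt0.
have /choice [k kP] : forall n, exists k, (n <= k)%N /\ J n k.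
  by move=> n; have [uJ _] := JP n; have [m nm Jm] := uJ n; exists m.
have [n|l lP] := @geometric_limit R X (u \o k) 2.
  have [_ dJ] := JP n; have [_ kn] := kP n; have [_ kn1] := kP n.+1.
  by apply: dJ => //; apply: JS.
exists l => e e0 N; have [N' hN] := halves_le (2 * 2) e0.
exists (k (maxn N N')).
  by have [+ _] := kP (maxn N N'); apply: leq_trans; apply: leq_maxl.
exact: le_trans (lP _) (hN _ (leq_maxr _ _)).
Qed.

(** A finite net in the unit ball of the kernel spans a subspace that
    approximates every z in the kernel within |z| / 2. Applying this to the
    successive errors shows that the subspace is dense in the kernel; it is
    also closed. *)
Lemma coverable_finite_kernel S c : linear S -> 0 < c ->
  coverable (almost_kernel S c) (1 / 4) -> finite_dimensional (S @^-1` [set 0]).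
Proof.
move=> linS c0 cov.
have S0 := linear_at0 linS.
have [||s [sK sP]] := @coverable_net R X [set x | S x = 0 /\ rnorm x <= 1] (1 / 4).
- by rewrite /= rnorm0 ler01.
- have [T [f fP]] := cov; exists T, f => x y [Sx x1] [Sy y1]; apply: fP; split=> //.
    by rewrite Sx rnorm0 ltW.
  by rewrite Sy rnorm0 ltW.
apply/finite_dimensionalP; exists s; apply/seteqP; split=> [x /= Sx|]; last first.
  apply: lspan_min => //= [a x y|v /sK []] //.
  by rewrite (linear_add linS) (linear_scale linS) => -> ->; rewrite scaler0 addr0.
have half z : S z = 0 -> exists z', [/\ lspan s z', S z' = 0 & rnorm (z - z') <= rnorm z / 2].
  move=> Sz; have [->|z0] := pselect (z = 0).
    by exists 0; split; rewrite ?subr0 ?rnorm0 ?mul0r //; apply: lspan0.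
  have nz := rnorm_gt0 z0; have nV : 0 <= (rnorm z)^-1 by rewrite invr_ge0 ltW.
  have [|w ws zw] := sP ((rnorm z)^-1%:C *: z).
    split; first by rewrite (linear_scale linS) Sz scaler0.
    by rewrite rnormZr // mulVf // gt_eqF.
  have [Sw w1] := sK w ws.
  exists ((rnorm z)%:C *: w); split.
  - exact/lspanZ/mem_lspan.
  - by rewrite (linear_scale linS) Sw scaler0.
  have zC : (rnorm z)%:C != 0 by rewrite (inj_eq (@complexI R)) gt_eqF.
  rewrite -[X in rnorm (X - _)](scalerKV zC) -scalerBr -fmorphV rnormZr ?(ltW nz) //.
  by apply: ler_wpM2l; [exact: ltW|lra].
have iter n : exists z, [/\ lspan s z, S z = 0 & rnorm (x - z) <= rnorm x * 2^-1 ^+ n].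
  elim: n => [|n [z [sz Sz xz]]].
    by exists 0; split; rewrite ?subr0 ?expr0 ?mulr1 //; apply: lspan0.
  have [|z' [sz' Sz' zz']] := half (x - z).
    by rewrite (linear_sub linS) Sx Sz subr0.
  exists (z + z'); split; first exact: lspanD.
    by rewrite (linear_add linS) Sz Sz' addr0.
  by rewrite opprD addrA exprS; lra.
apply: (closed_approx (@lspan_closed _ _ s)) => e e0.
have [N hN] := halves_le (rnorm x) e0; have [z [sz _ xz]] := iter N.
by exists z => //; apply: le_trans xz (hN N _).
Qed.

(** Otherwise there are unit vectors u n at distance at least 1/2 from the
    kernel whose images tend to 0; an accumulation point of u would be an
    element of the kernel within 1/4 of some u n. *)
Lemma coverable_ker_dist S c : linear S -> 0 < c ->
  (exists2 M, 0 < M & forall x, rnorm (S x) <= M * rnorm x) ->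
  coverable (almost_kernel S c) (1 / 4) -> exists2 C, 0 < C & ker_dist_le S C.
Proof.
move=> linS c0 [M M0 SM] cov; apply: contrapT => nC.
have S0 := linear_at0 linS.
have /choice [u uP] : forall n : nat, exists u, [/\ rnorm u <= 1,
    rnorm (S u) <= n.+1%:R^-1 & forall z, S z = 0 -> 1 / 2 <= rnorm (u - z)].
  move=> n; have [x xP] : exists x, forall z, S z = 0 ->
      n.+1%:R * rnorm (S x) < rnorm (x - z).
    apply: contrapT => nx; apply: nC; exists n.+1%:R; rewrite ?ltr0n // => x.
    apply: contrapT => nz; apply: nx; exists x => z Sz; rewrite ltNge.
    by apply/negP => xz; apply: nz; exists z.
  have Sx0 : S x <> 0.
    by move=> Sx0; have := xP x Sx0; rewrite Sx0 subrr rnorm0 mulr0 ltxx.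
  have nSx := rnorm_gt0 Sx0.
  (* The vector u n is x - z, normalized, where z is in the kernel and
     almost realizes the distance d from x to the kernel. *)
  pose D := [set rnorm (x - z) | z in S @^-1` [set 0]].
  pose d := inf D.
  have hD : has_inf D.
    split; first by exists (rnorm (x - 0)), 0.
    by exists 0 => _ [z _ <-]; apply: rnorm_ge0.
  have dge : n.+1%:R * rnorm (S x) <= d.
    by apply: lb_le_inf; [case: hD|move=> _ [z Sz <-]; apply/ltW/xP].
  have d0 : 0 < d by apply: lt_le_trans dge; rewrite mulr_gt0 // ltr0n.
  have [_ [z Sz <-] xz] := inf_adherent d0 hD.
  have dle z' : S z' = 0 -> d <= rnorm (x - z').
    by move=> Sz'; apply: ge_inf; [case: hD|exists z'].
  set t := rnorm (x - z) in xz.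
  have dt := dle z Sz; have t0 : 0 < t by apply: lt_le_trans dt.
  have tV : 0 <= t^-1 by rewrite invr_ge0 ltW.
  exists (t^-1%:C *: (x - z)); split.
  - by rewrite rnormZr // mulVf // gt_eqF.
  - rewrite (linear_scale linS) rnormZr // (linear_sub linS) Sz subr0.
    rewrite mulrC ler_pdivrMr // mulrC ler_pdivlMr ?ltr0n // mulrC.
    exact: le_trans dt.
  move=> z' Sz'; have tC : t%:C != 0 by rewrite (inj_eq (@complexI R)) gt_eqF.
  rewrite -[z'](scalerK tC) -fmorphV -scalerBr rnormZr // [leRHS]mulrC ler_pdivlMr //.
  rewrite -addrA -opprD; apply: le_trans (dle _ _).
    by move: xz; rewrite -/d; lra.
  by rewrite (linear_add linS) (linear_scale linS) Sz Sz' scaler0 addr0.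
have Su e : 0 < e -> exists N, forall n, (N <= n)%N -> rnorm (S (u n)) <= e.
  move=> e0; exists (Num.bound e^-1) => n Nn; have [_ + _] := uP n.
  move/le_trans; apply; rewrite -[leRHS]invrK lef_pV2 ?posrE ?invr_gt0 ?ltr0n //.
  have : e^-1 < (Num.bound e^-1)%:R by apply: archi_boundP; rewrite invr_ge0 ltW.
  have : (Num.bound e^-1)%:R <= n.+1%:R :> R by rewrite ler_nat leqW.
  lra.
have [//|l lP] := accumulation_point linS c0 cov _ Su.
  by move=> n; have [] := uP n.
have Sl : S l = 0.
  apply: rnorm_small_eq0 => e e0; have e20 : 0 < e / 2 by lra.
  have [N hN] := Su _ e20; have eM : 0 < e / 2 / M by rewrite divr_gt0.
  have [n Nn ln] := lP _ eM N.
  have -> : S l = S (l - u n) + S (u n) by rewrite -(linear_add linS) subrK.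
  have := rnormD (S (l - u n)) (S (u n)); have := hN n Nn; have := SM (l - u n).
  move: ln; rewrite ler_pdivlMr //; lra.
have e40 : 0 < 1 / 4 :> R by lra.
have [n _ ln] := lP _ e40 0%N; have [_ _ /(_ l Sl)] := uP n.
rewrite rnorm_sub; lra.
Qed.

(** The scale 1/4 suffices because the rescaling in [accumulation_point] and
    the iteration in [coverable_finite_kernel] recover all smaller scales. *)
Lemma coverable_Phi_plus S c : bounded_operator S -> 0 < c ->
  coverable (almost_kernel S c) (1 / 4) -> Phi_plus S.
Proof.
move=> bS c0 cov; have [linS MS] := (bounded_operatorP _).1 bS.
have [C C0 SC] := coverable_ker_dist linS c0 MS cov.
split=> //; first exact: ker_dist_closed_range SC.
exact: coverable_finite_kernel cov.
Qed.

(** The almost kernel of S at level c contains that of S' at level c / 2 when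
    S' is within c / 2 of S, so the same colouring serves for S'. The
    criterion thus gives stability without complementing the kernel, for
    which the Hahn-Banach theorem would be needed. *)
Lemma Phi_plus_open S : Phi_plus S -> exists2 d, 0 < d & forall S',
  bounded_operator S' -> (forall x, rnorm (S x - S' x) <= d * rnorm x) ->
  Phi_plus S'.
Proof.
move=> PS; have e40 : 0 < 1 / 4 :> R by lra.
have [c c0 [T [f fP]]] := Phi_plus_coverable PS e40.
have c20 : 0 < c / 2 by lra.
exists (c / 2) => // S' bS' SS'; apply: (coverable_Phi_plus bS' c20).
have sub x : almost_kernel S' (c / 2) x -> almost_kernel S c x.
  move=> [x1 Sx]; split=> //.
  have -> : S x = (S x - S' x) + S' x by rewrite subrK.
  by have := rnormD (S x - S' x) (S' x); have := SS' x; nra.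
by exists T, f => x y /sub Kx /sub Ky; apply: fP.
Qed.

(** A multiple of A maps the almost kernel of S into that of S', where a
    colouring at an arbitrarily fine scale exists; its pullback by A loses only
    the factors contributed by the norms of A and of its left inverse. *)
Lemma Phi_plus_left_invertible S S' A (k : R) : Phi_plus S' -> bounded_operator S ->
  bounded_operator A -> left_invertible A ->
  (forall x, rnorm (S' (A x)) <= k * rnorm (S x)) -> Phi_plus S.
Proof.
move=> PS' bS /bounded_operatorP [linA [a a0 Aa]] [B [bB BA]] SA.
have [linB [b b0 Bb]] := (bounded_operatorP _).1 bB.
have linS' : linear S' by case: PS' => -[].
have e0 : 0 < 1 / 4 / (b * a) by rewrite divr_gt0 ?mulr_gt0 //; lra.
have [c c0 [T [f fP]]] := Phi_plus_coverable PS' e0.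
pose c' := c * a / (`|k| + 1).
have k0 : 0 < `|k| + 1 by rewrite ltr_wpDl.
have c'0 : 0 < c' by rewrite divr_gt0 // mulr_gt0.
apply: (coverable_Phi_plus bS c'0).
pose g x := a^-1%:C *: A x.
have aV : 0 <= a^-1 by rewrite invr_ge0 ltW.
have gK x : almost_kernel S c' x -> almost_kernel S' c (g x).
  move=> [x1 Sx]; split.
    rewrite rnormZr // mulrC ler_pdivrMr // mul1r (le_trans (Aa x)) //.
    by rewrite ger_pMr.
  rewrite (linear_scale linS') rnormZr // mulrC ler_pdivrMr //.
  apply: le_trans (SA x) _; move: Sx; rewrite ler_pdivlMr // => Sx.
  have := ler_norm k; have := rnorm_ge0 (S x); nra.
exists T, (f \o g) => x y Kx Ky /(fP _ _ (gK _ Kx) (gK _ Ky)).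
rewrite /g -scalerBr -(linear_sub linA) rnormZr // mulrC ler_pdivrMr // => h.
have -> : x - y = B (A (x - y)) by rewrite -[RHS]/((B \o A) _) BA.
apply: le_trans (Bb _) _; apply: le_trans (ler_wpM2l (ltW b0) h) _.
by rewrite mulrCA divfK // gt_eqF // mulr_gt0.
Qed.

End Criterion.

(** * Rotation of the spectra *)

Section Rotation.
Context {R : realType}.
Implicit Types (gamma lambda mu : R[i]).

(** Two powers of gamma share a cell of the grid; dividing by the smaller one
    brings their quotient close to 1. *)
Lemma unit_power_recurrent gamma (e : R) : Normc.normc gamma = 1 -> 0 < e ->
  exists k, Normc.normc (gamma ^+ k.+1 - 1) <= e.
Proof.
move=> g1 e0; have gX n : Normc.normc (gamma ^+ n) = 1.
  elim: n => [|n IH]; first by rewrite expr0 Normc.normc1.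
  by rewrite exprS Normc.normcM g1 IH mulr1.
have [T [f fP]] := complex_grid 1 e0.
have [|t ut] := @unbounded_pigeonhole T (fun n => f (gamma ^+ n)) setT.
  by move=> N; exists N.
have [m _ [_ fm]] := ut 0%N; have [n mn [_ fn]] := ut m.+1.
exists (n - m.+1)%N.
have := fP (gamma ^+ n) (gamma ^+ m); rewrite !gX !lexx fm fn => /(_ erefl erefl erefl).
have nE : n = (m + (n - m.+1).+1)%N by rewrite -subSn // subSS subnKC // ltnW.
by rewrite {1}nE exprD -{2}[gamma ^+ m]mulr1 -mulrBr Normc.normcM gX mul1r.
Qed.

(** For negative exponents: since gamma^(k+1) comes close to 1, the points
    gamma^k mu come close to gamma^(-1) mu, so a property that passes to limits
    and to multiples by gamma also passes to multiples by gamma^(-1). *)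
Lemma rotation_invariant_closed (P : R[i] -> Prop) gamma lambda :
  Normc.normc gamma = 1 -> (forall mu, P mu -> P (gamma * mu)) ->
  (forall mu, (forall e, 0 < e -> exists2 nu, P nu & Normc.normc (nu - mu) <= e) ->
    P mu) ->
  P lambda -> forall n : int, P (gamma ^ n * lambda).
Proof.
move=> g1 Pg Pc Pl.
have g0 : gamma != 0.
  apply/eqP => g0; move: g1; rewrite g0 Normc.normc0 => /eqP.
  by rewrite eq_sym oner_eq0.
have PgX k mu : P mu -> P (gamma ^+ k * mu).
  by elim: k => [|k IH] Pmu; rewrite ?expr0 ?mul1r // exprS -mulrA; apply/Pg/IH.
have PgV mu : P mu -> P (gamma^-1 * mu).
  move=> Pmu; apply: Pc => e e0.
  have m0 := normc_ge0 mu; have m10 : 0 < Normc.normc mu + 1 by rewrite ltr_wpDl.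
  have [k gk] := unit_power_recurrent g1 (divr_gt0 e0 m10).
  exists (gamma ^+ k * mu); first exact: PgX.
  have -> : gamma ^+ k * mu - gamma^-1 * mu = gamma^-1 * (gamma ^+ k.+1 - 1) * mu.
    by rewrite mulrBr exprS mulKf // mulr1 mulrBl.
  rewrite !Normc.normcM Normc.normcV g1 invr1 mul1r.
  move: gk; rewrite ler_pdivlMr //; have := normc_ge0 (gamma ^+ k.+1 - 1); nra.
case=> n; first by rewrite -exprnP; apply: PgX.
rewrite NegzE -exprnN -exprVn; elim: n.+1 => [|k IH]; first by rewrite expr0 mul1r.
by rewrite exprS -mulrA; apply: PgV.
Qed.

Context {X : completeNormedModType R[i]}.
Implicit Types (T U w A : X -> X) (x : X).

Lemma sigma_ap_approx T lambda (e : R) : sigma_ap T lambda -> 0 < e ->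
  exists2 x, rnorm x = 1 & rnorm (T x - lambda *: x) <= e.
Proof.
move=> [x [x1 /(cvgrPdist_le _ _).1 Tx]] e0.
have [|N _ TN] := Tx e%:C; first by rewrite ltcR.
exists (x N); first by apply: complexI; rewrite -rnormE x1.
by have := TN N (leqnn N); rewrite /= sub0r normrN rnormE lecR.
Qed.

Lemma approx_sigma_ap T lambda : linear T ->
  (forall e, 0 < e -> exists2 x, 0 < rnorm x &
    rnorm (T x - lambda *: x) <= e * rnorm x) ->
  sigma_ap T lambda.
Proof.
move=> linT Tl.
have /choice [u uP] : forall n, exists u, rnorm u = 1 /\
    rnorm (T u - lambda *: u) <= 2^-1 ^+ n.
  move=> n; have [|x x0 xP] := Tl (2^-1 ^+ n); first by rewrite exprn_gt0.
  have xV : 0 <= (rnorm x)^-1 by rewrite invr_ge0 ltW.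
  exists ((rnorm x)^-1%:C *: x); split; first by rewrite rnormZr // mulVf // gt_eqF.
  rewrite (linear_scale linT) scalerA mulrC -scalerA -scalerBr rnormZr //.
  by rewrite mulrC ler_pdivrMr.
exists u; split; first by move=> n; have [u1 _] := uP n; rewrite rnormE u1.
apply/cvgrPdist_le => e e0.
have eE : e = (complex.Re e)%:C by rewrite RRe_real // gtr0_real.
have [|N hN] := @halves_le R 1 (complex.Re e); first by rewrite -ltcR -eE.
exists N => // n /= Nn; rewrite sub0r normrN rnormE eE lecR.
by have [_] := uP n; have := hN n Nn; lra.
Qed.

Lemma sigma_ap_closed T mu : linear T ->
  (forall e, 0 < e -> exists2 nu, sigma_ap T nu & Normc.normc (nu - mu) <= e) ->
  sigma_ap T mu.
Proof.
move=> linT Tmu; apply: approx_sigma_ap => // e e0; have e20 : 0 < e / 2 by lra.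
have [nu Tnu numu] := Tmu _ e20; have [x x1 xP] := sigma_ap_approx Tnu e20.
exists x; rewrite x1 // mulr1.
have -> : T x - mu *: x = (T x - nu *: x) + (nu - mu) *: x.
  by rewrite scalerBl addrA subrK.
apply: le_trans (rnormD _ _) _; rewrite rnormZ x1; lra.
Qed.

(** A maps approximate eigenvectors for mu to approximate eigenvectors for
    gamma mu, and its left inverse prevents their norms from collapsing. *)
Lemma sigma_ap_rotate T A gamma mu : bounded_operator T -> bounded_operator A ->
  left_invertible A -> Normc.normc gamma = 1 ->
  (forall x, T (A x) = gamma *: A (T x)) ->
  sigma_ap T mu -> sigma_ap T (gamma * mu).
Proof.
move=> [linT _] /bounded_operatorP [linA [a a0 Aa]] [B [bB BA]] g1 TA Tmu.
have [linB [b b0 Bb]] := (bounded_operatorP _).1 bB.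
apply: approx_sigma_ap => // e e0.
have ab0 : 0 < e / (a * b) by rewrite divr_gt0 // mulr_gt0.
have [x x1 xP] := sigma_ap_approx Tmu ab0.
have bA : 1 <= b * rnorm (A x).
  by rewrite -x1 -[X in rnorm X <= _]/(id x) -BA; apply: Bb.
exists (A x); first by rewrite -(pmulr_rgt0 _ b0) (lt_le_trans _ bA).
rewrite TA -scalerA -scalerBr -(linear_scale linA) -(linear_sub linA) rnormZ g1 mul1r.
apply: le_trans (Aa _) _; move: xP; rewrite ler_pdivlMr ?mulr_gt0 // => xP.
have := rnorm_ge0 (T x - mu *: x) => n0.
rewrite -(ler_pM2l b0); apply: le_trans (_ : e * 1 <= _); first by lra.
by rewrite mulrCA ler_wpM2l // ltW.
Qed.

Lemma bounded_resolvent T mu : bounded_operator T -> bounded_operator (mu \*: id \- T).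
Proof.
move=> /bounded_operatorP [linT [M M0 TM]]; apply/bounded_operatorP; split.
  move=> a x y /=; rewrite linT scalerDr opprD addrACA scalerBr.
  by rewrite !scalerA [mu * a]mulrC.
exists (Normc.normc mu + M); first by rewrite ltr_wpDl // normc_ge0.
by move=> x; rewrite /= (le_trans (rnormB _ _)) // mulrDl rnormZ lerD.
Qed.

Lemma sigma_2_closed T mu : bounded_operator T ->
  (forall e, 0 < e -> exists2 nu, sigma_2 T nu & Normc.normc (nu - mu) <= e) ->
  sigma_2 T mu.
Proof.
move=> bT Tmu /Phi_plus_open [d d0 dP]; have [nu Tnu numu] := Tmu d d0.
apply: Tnu; apply: dP => [|x]; first exact: bounded_resolvent.
rewrite rnorm_sub /= opprB addrA subrK -scalerBl rnormZ.
by rewrite ler_wpM2r // rnorm_ge0.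
Qed.

(** Since (gamma mu - T) A = gamma A (mu - T), the operator mu - T is upper
    semi-Fredholm as soon as gamma mu - T is. *)
Lemma sigma_2_rotate T A gamma mu : bounded_operator T -> bounded_operator A ->
  left_invertible A -> Normc.normc gamma = 1 ->
  (forall x, T (A x) = gamma *: A (T x)) ->
  sigma_2 T mu -> sigma_2 T (gamma * mu).
Proof.
move=> bT bA lA g1 TA Tmu PT; apply: Tmu.
have [linA [a a0 Aa]] := (bounded_operatorP _).1 bA.
apply: (Phi_plus_left_invertible PT (bounded_resolvent mu bT) bA lA (k := a)) => x.
rewrite /= TA -scalerA -scalerBr -(linear_scale linA) -(linear_sub linA) rnormZ g1 mul1r.
exact: Aa.
Qed.

Lemma weighted_rotation_intertwine U w A gamma x : rotation_set U A ->
  commutant (rotation_set U) w -> rotation_coefficient U A gamma ->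
  w (U (A x)) = gamma *: A (w (U x)).
Proof.
move=> UA [[linw _] wA] [_ [V [[_ VU _] UAV]]].
have -> : U (A x) = gamma *: A (U x).
  have := congr1 (fun f => f (U x)) UAV; rewrite /=.
  by have := congr1 (fun f => f x) VU; rewrite /= => ->.
by rewrite (linear_scale linw) -[A (w _)]/((A \o w) _) -(wA A UA).
Qed.

End Rotation.

Theorem theorem3p5 (R : realType) (X : completeNormedModType R[i])
    (U w A : X -> X) (lambda gamma : R[i])
    (hU : rotation_like U)
    (hw : commutant (rotation_set U) w)
    (hlambda : sigma_ap (w \o U) lambda)
    (hA : rotation_set U A)
    (hgamma : rotation_coefficient U A gamma)
    (hleft : left_invertible A) :
  (forall n : int, sigma_ap (w \o U) (gamma ^ n * lambda)) /\
  (sigma_2 (w \o U) lambda ->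
   forall n : int, sigma_2 (w \o U) (gamma ^ n * lambda)).
Proof.
have g1 : Normc.normc gamma = 1.
  by apply: complexI; rewrite -normcE_real; case: hgamma.
have bT : bounded_operator (w \o U).
  have [/bounded_operatorP [linw [M M0 wM]] _] := hw.
  have [/bounded_operatorP [linU [N N0 UN]] _ _] := hU.
  apply/bounded_operatorP; split.
    by move=> c x y /=; rewrite linU linw.
  exists (M * N); first by rewrite mulr_gt0.
  by move=> x; rewrite /= -mulrA (le_trans (wM _)) // ler_wpM2l // ltW.
have TA x : (w \o U) (A x) = gamma *: A ((w \o U) x).
  exact: weighted_rotation_intertwine hA hw hgamma.
have [bA _ _] := hA.
split=> [|l2].
  apply: (rotation_invariant_closed (P := sigma_ap (w \o U))) => // mu.
    exact: (sigma_ap_rotate bT bA).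
  by apply: sigma_ap_closed; case: bT.
apply: (rotation_invariant_closed (P := sigma_2 (w \o U))) => // mu.
  exact: (sigma_2_rotate bT bA).
exact: sigma_2_closed.
Qed.
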